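(* Let $(X_n)_{n\ge0}$ be the Kendall random walk with step distribution $\nu\in\mathcal P_s$, $\nu(\{0\})=0$, let $a>0$ with $\nu(\{a\})=0$ and $G(a)\ne\frac12$, and let $\tau_a^+=\min\{n\ge1:X_n>a\}$. Then for every $n\in\mathbb N$, $n\ge1$, $$\mathbb P(\tau_a^+=n)=A(a)\Big(\frac12\Big)^n+B(a)\,n\,(1-G(a))^2G(a)^{n-1}+C(a)\,G(a)^{n-1}(1-G(a)),$$ where $$A(a)=1+\frac{H(a)}{(2G(a)-1)^2}-\frac{G(a)}{2G(a)-1},\quad B(a)=\frac{H(a)}{(2G(a)-1)(1-G(a))},\quad C(a)=\frac{G(a)}{2G(a)-1}-\frac{H(a)}{(2G(a)-1)^2}\frac{G(a)}{1-G(a)},$$ and $A(a)+B(a)+C(a)=1$.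
   Context: Fix $\alpha>0$. $\mathcal P_s$ is the set of symmetric Borel probability measures on $\mathbb R$. For $x\in\mathbb R$, $\widetilde\delta_x=\frac12(\delta_x+\delta_{-x})$. For a probability measure $\lambda=\mathcal L(X)$ and $c>0$, $T_c\lambda=\mathcal L(cX)$, and $T_0\lambda=\delta_0$. $\widetilde\pi_{2\alpha}$ is the symmetric Pareto probability measure with density $\alpha|y|^{-2\alpha-1}\mathbf 1_{\{|y|\ge1\}}$. The Kendall convolution $\vartriangle_\alpha$ on $\mathcal P_s$ is defined by $\widetilde\delta_x\vartriangle_\alpha\widetilde\delta_y=T_M\big(\varrho^\alpha\widetilde\pi_{2\alpha}+(1-\varrho^\alpha)\widetilde\delta_1\big)$ where $M=\max(|x|,|y|)$, $m=\min(|x|,|y|)$, $\varrho=m/M$ (and $\varrho=0$ if $M=0$), extended by $(\nu_1\vartriangle_\alpha\nu_2)(A)=\int\int(\widetilde\delta_x\vartriangle_\alpha\widetilde\delta_y)(A)\,\nu_1(dx)\nu_2(dy)$. For $x\in\mathbb R$ and $\mu\in\mathcal P_s$ we write $\delta_x\vartriangle_\alpha\mu:=\widetilde\delta_x\vartriangle_\alpha\mu$. $\Psi(t)=(1-|t|^\alpha)_+$. For the measure $\nu$: $F(t)=\nu((-\infty,t])$, $G(t)=\int_{\mathbb R}\Psi(x/t)\,\nu(dx)$ for $t\neq0$, and for $t>0$, $H(t)=2F(t)-1-G(t)=t^{-\alpha}\int_{[-t,t]}|x|^\alpha\nu(dx)$. The Kendall random walk with step distribution $\nu$ is the Markov chain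 $(X_n)_{n\ge0}$ with $X_0=0$ and transition kernel $\mathbb P(X_{k+1}\in A\mid X_k=x)=(\delta_x\vartriangle_\alpha\nu)(A)$. *)

(* Defs.v *)
From HB Require Import structures.
From mathcomp Require Import all_boot all_order all_algebra.
From mathcomp Require Import all_classical all_reals all_analysis.
Set Implicit Arguments. Unset Strict Implicit. Unset Printing Implicit Defensive.
Import Order.TTheory GRing.Theory Num.Theory.
Import numFieldNormedType.Exports.
Local Open Scope classical_set_scope.
Local Open Scope ring_scope.

Section Kendall.
Variables (R : realType) (alpha : R).

Definition Psi (t : R) : R := Num.max (1 - `|t| `^ alpha) 0.

Definition pareto_density (z : R) : R :=
  if 1 <= `|z| then alpha * `|z| `^ (- (2 * alpha + 1)) else 0.

(* integral of f against  delta~_x (Kendall conv) delta~_y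
   = T_M( rho^alpha pi~_{2alpha} + (1 - rho^alpha) delta~_1 ),
   M = max(|x|,|y|), m = min(|x|,|y|), rho = m/M (rho = 0 if M = 0). *)
Definition kendall_pair_int (f : R -> \bar R) (x y : R) : \bar R :=
  let M := Num.max `|x| `|y| in
  let m := Num.min `|x| `|y| in
  let rho := if M == 0 then 0 else m / M in
  let g := fun z : R => (f (M * z)%R * (pareto_density z)%:E)%E in
  ((rho `^ alpha)%:E * (\int[@lebesgue_measure R]_(z in setT) g z)
   + ((1 - rho `^ alpha) / 2)%:E * (f M + f (- M)%R))%E.

(* integral of f against  delta_x (Kendall conv) nu  (transition kernel) *)
Definition kendall_kernel (nu : probability R R) (f : R -> \bar R) (x : R)
  : \bar R :=
  (\int[nu]_(y in setT) kendall_pair_int f x y)%E.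

(* h k y = P_y(X_1 <= a, ..., X_k <= a, X_{k+1} > a) evaluated one step
   earlier: h 0 = 1_{(a,oo)}, h (k+1) y = 1_{y <= a} * (K h k)(y). *)
Fixpoint first_passage_aux (nu : probability R R) (a : R) (k : nat)
  : R -> \bar R :=
  match k with
  | 0%N => fun y => (if a < y then 1 else 0)%:E
  | k'.+1 => fun y =>
      if y <= a then kendall_kernel nu (first_passage_aux nu a k') y else 0%E
  end.

(* P(tau_a^+ = n) = P(X_1 <= a, ..., X_{n-1} <= a, X_n > a) for the Kendall
   random walk started at X_0 = 0 with step distribution nu (n >= 1). *)
Definition prob_tau (nu : probability R R) (a : R) (n : nat) : \bar R :=
  kendall_kernel nu (first_passage_aux nu a n.-1) 0.

Definition cdfF (nu : probability R R) (t : R) : R :=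
  fine (nu `]-oo, t]%classic).

Definition funG (nu : probability R R) (t : R) : R :=
  fine (\int[nu]_(x in setT) (Psi (x / t))%:E)%E.

Definition funH (nu : probability R R) (t : R) : R :=
  2 * cdfF nu t - 1 - funG nu t.

Definition symmetric_measure (nu : probability R R) : Prop :=
  forall A : set R, measurable A -> nu ((fun x => - x) @^-1` A) = nu A.

End Kendall.

(* Main.v *)
(* With u(x) = (|x|/a)^alpha, integrating 1_{[-a,a]} (p (1 - u) + r u) against
   delta_x (Kendall conv) delta_y gives, for x, y in [-a, a], the bilinear value
   p (1-u(x))(1-u(y)) + r (u(x)(1-u(y)) + (1-u(x))u(y)), while the mass u(x)u(y)
   leaves [-a, a] with a fair sign.  Averaging over nu, the walk killed above a
   acts on the pair (p, r) by the triangular recursion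
     p' = c (1 - G - H) + G p + H r,   r' = c (1 - G) + G r,   c = 2^-(n+1),
   whose double eigenvalue G produces the term n G^(n-1). *)
Require Import Defs.
From HB Require Import structures.
From mathcomp Require Import all_boot all_order all_algebra.
From mathcomp Require Import all_classical all_reals all_analysis.
From mathcomp Require Import measurable_realfun ring lra.
Import Order.TTheory GRing.Theory Num.Theory.
Import numFieldNormedType.Exports.
Local Open Scope classical_set_scope.
Local Open Scope ring_scope.

(** * Integrals of power functions and folding of integrals at the origin *)

Section PowerIntegrals.
Context {R : realType}.
Local Notation leb := (@lebesgue_measure R).

Lemma continuous_powR (s x : R) : 0 < x -> {for x, continuous (@powR R ^~ s)}.
Proof.
move=> x0; apply/differentiable_continuous/derivable1_diffP.
exact/ex_derive/is_derive1_powR.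
Qed.

Lemma is_derive_scale_powR (c s x : R) : 0 < x ->
  is_derive (x : R) (1 : R) (fun z : R => c * z `^ s) (c * (s * x `^ (s - 1))).
Proof.
by move=> x0; exact: (@is_deriveZ R R^o R^o _ c x 1 _ (is_derive1_powR s x0)).
Qed.

Lemma powR_cvgy0 (s : R) : 0 < s -> z `^ (- s) @[z --> +oo] --> (0 : R).
Proof.
move=> s0; apply/cvgrPdist_lt => e e0; near=> z.
have z0 : 0 < z by near: z; exact: nbhs_pinfty_gt.
(* The threshold solves z^(-s) = e, so every larger z satisfies z^(-s) < e. *)
have ez : e^-1 `^ s^-1 < z by near: z; exact: nbhs_pinfty_gt.
rewrite sub0r normrN ger0_norm ?powR_ge0// powRN invf_plt ?posrE ?powR_gt0//.
have -> : e^-1 = (e^-1 `^ s^-1) `^ s.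
  by rewrite -powRrM mulVf ?gt_eqF// powRr1// ltW// invr_gt0.
by rewrite gt0_ltr_powR// nnegrE ?powR_ge0// ltW.
Unshelve. all: by end_near. Qed.

Lemma integral_powR_tail (k s b : R) : 0 <= k -> 0 < s -> 0 < b ->
  (\int[leb]_(z in `[b, +oo[) (k * z `^ (- (s + 1)))%:E
   = (k / s * b `^ (- s))%:E)%E.
Proof.
move=> k0 s0 b0.
have dF (x : R) : 0 < x -> is_derive x 1 (fun z : R => - (k / s) * z `^ (- s))
    (k * x `^ (- (s + 1))).
  move=> x0; have := is_derive_scale_powR (- (k / s)) (- s) x x0.
  congr is_derive.
  rewrite opprD mulrA; congr (_ * _).
  by rewrite mulrNN divfK// gt_eqF.
rewrite (@ge0_continuous_FTC2y _ _ (fun z => - (k / s) * z `^ (- s)) _ 0).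
- by rewrite -EFinB sub0r mulNr opprK.
- by move=> x bx; rewrite mulr_ge0// powR_ge0.
- apply: continuous_in_subspaceT => x; rewrite inE/= in_itv/= andbT => bx.
  by apply: cvgMr; apply: continuous_powR; exact: lt_le_trans bx.
- rewrite -[X in _ --> X](mulr0 (- (k / s))); apply: cvgMr; exact: powR_cvgy0.
- by move=> x bx; have [] := dF x (lt_trans b0 bx).
- by apply: cvg_at_right_filter; apply: cvgMr; exact: continuous_powR.
- move=> x; rewrite in_itv/= andbT => bx.
  by rewrite derive1E; have [_ ->] := dF x (lt_trans b0 bx).
Qed.

(** The Pareto density is even but the functions integrated against it are not; folding moves
    everything to the positive half-line, where only the sum of the values at z and -z matters. *)
Lemma ge0_integral_fold (g : R -> R) : measurable_fun [set: R] g ->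
  (forall z, 0 <= g z) ->
  (\int[leb]_z (g z)%:E = \int[leb]_(z in `[(0:R)%R, +oo[) (g z + g (- z))%:E)%E.
Proof.
move=> mg g0.
have mgE : measurable_fun [set: R] (fun z : R => (g z)%:E).
  exact/measurable_EFinP.
have mgN : measurable_fun [set: R] (fun z : R => g (- z)).
  exact: measurableT_comp.
rewrite -(setUv [set x : R | 0 <= x]) -set_itvcy ge0_integral_setU//=; first last.
- exact/disj_setPCl.
- by move=> x _; rewrite lee_fin.
- by rewrite setUv.
- exact: measurableC.
(* The negative half-line is closed at 0, a null set, so that the reflection z to -z maps it onto
   the domain of the other integral. *)
rewrite setCitvr integral_itv_bndo_bndc; last exact: measurable_funTS.
under [RHS]eq_integral do rewrite EFinD.
rewrite ge0_integralD//; last 4 first.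
- by move=> x _; rewrite lee_fin.
- exact: measurable_funTS.
- by move=> x _; rewrite lee_fin.
- by apply: measurable_funTS; exact/measurable_EFinP.
congr (_ + _)%E.
rewrite (@ge0_integration_by_substitution0 _ (fun z => (g (- z))%:E)).
- by apply: eq_integral => x _; rewrite opprK.
- exact/measurable_EFinP.
- by move=> x; rewrite lee_fin.
Qed.

(** With s = alpha, the exponent -(2s+1) comes from the Pareto density alone and -(s+1) from that
    density multiplied by z^alpha. *)
Lemma integral_powR_segment (k l s b : R) : 0 < s -> 1 <= b ->
  (\int[leb]_(z in `[(1:R)%R, b])
     (k * z `^ (- (2 * s + 1)) + l * z `^ (- (s + 1)))%:E
   = (k / (2 * s) * (1 - b `^ (- (2 * s))) + l / s * (1 - b `^ (- s)))%:E)%E.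
Proof.
move=> s0; rewrite le_eqVlt => /predU1P[<-|b1].
  (* The fundamental theorem needs a nondegenerate interval, so b = 1 is treated apart: a single
     point has integral 0. *)
  by rewrite !powR1 !subrr !mulr0 addr0 set_itv1 integral_set1.
set F := fun z : R => - (k / (2 * s)) * z `^ (- (2 * s)) + - (l / s) * z `^ (- s).
have dF (x : R) : 0 < x -> is_derive x 1 F
    (k * x `^ (- (2 * s + 1)) + l * x `^ (- (s + 1))).
  move=> x0; have dk := is_derive_scale_powR (- (k / (2 * s))) (- (2 * s)) x x0.
  have dl := is_derive_scale_powR (- (l / s)) (- s) x x0.
  have := @is_deriveD R R^o R^o _ _ x 1 _ _ dk dl; congr is_derive.
  rewrite !opprD; congr (_ + _); rewrite mulrA; congr (_ * _); rewrite mulrNN.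
    by rewrite divfK// mulf_neq0 ?gt_eqF.
  by rewrite divfK// gt_eqF.
have cF (x : R) : 0 < x -> {for x, continuous F}.
  move=> x0; apply/differentiable_continuous/derivable1_diffP.
  by have [] := dF x x0.
rewrite (@continuous_FTC2 _ _ F)//.
- by rewrite -EFinB /F !powR1; congr EFin; ring.
- apply: continuous_in_subspaceT => x; rewrite inE/= in_itv/= => /andP[x1 _].
  have x0 : 0 < x by exact: lt_le_trans x1.
  by apply: cvgD; apply: cvgMr; exact: continuous_powR.
- split.
  + move=> x; rewrite in_itv/= => /andP[x1 _].
    by have [] := dF x (lt_trans ltr01 x1).
  + by apply: cvg_at_right_filter; exact: cF.
  + by apply: cvg_at_left_filter; apply: cF; exact: lt_trans b1.
- move=> x; rewrite in_itv/= => /andP[x1 _].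
  by rewrite derive1E; have [_ ->] := dF x (lt_trans ltr01 x1).
Qed.

End PowerIntegrals.

(** * Kendall convolution of two symmetric point masses, tested on level-affine functions *)

Section KendallStep.
Context {R : realType}.
Variables (alpha a : R).
Hypotheses (alpha_gt0 : 0 < alpha) (a_gt0 : 0 < a).
Local Notation leb := (@lebesgue_measure R).

Definition level (x : R) : R := (`|x| / a) `^ alpha.

(** A four-parameter family containing every first-passage function: [p] is the value at the centre,
    [r] the value at the edges of [-a, a]. The outer values [cp] and [cm] are kept apart because
    passage is only counted above a, while the walk may also jump below -a. *)
Definition level_affine (cp cm p r x : R) : R :=
  if a < x then cp else if x < - a then cm
  else p * (1 - level x) + r * level x.

Lemma levelN x : level (- x) = level x.
Proof. by rewrite /level normrN. Qed.

Lemma level_ge0 x : 0 <= level x.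
Proof. exact: powR_ge0. Qed.

Lemma level0 : level 0 = 0.
Proof. by rewrite /level normr0 mul0r powR0// gt_eqF. Qed.

Lemma level_le1 x : `|x| <= a -> level x <= 1.
Proof.
move=> xa; rewrite [leRHS](_ : 1 = 1 `^ alpha); last by rewrite powR1.
have xa0 : 0 <= `|x| / a by rewrite divr_ge0// ltW.
by rewrite ge0_ler_powR ?nnegrE ?ler01 ?(ltW alpha_gt0)// ler_pdivrMr// mul1r.
Qed.

Lemma level_affine_in cp cm p r x : `|x| <= a ->
  level_affine cp cm p r x = p * (1 - level x) + r * level x.
Proof.
by rewrite ler_norml => /andP[ax xa]; rewrite /level_affine !ltNge xa ax.
Qed.

Lemma level_affine_gt cp cm p r x : a < x -> level_affine cp cm p r x = cp.
Proof. by rewrite /level_affine => ->. Qed.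

Lemma level_affine_lt cp cm p r x : x < - a -> level_affine cp cm p r x = cm.
Proof.
move=> xa; rewrite /level_affine xa ltNge (le_trans (ltW xa))//.
by rewrite ge0_cp// ltW.
Qed.

Lemma measurable_level : measurable_fun [set: R] level.
Proof.
have m : measurable_fun [set: R] (fun x : R => `|x| / a) by exact: measurable_funM.
exact: (measurableT_comp (measurable_powR alpha) m).
Qed.

Lemma measurable_level_affine cp cm p r :
  measurable_fun [set: R] (level_affine cp cm p r).
Proof.
apply: measurable_fun_ifT => //; first exact: measurable_fun_ltr.
apply: measurable_fun_ifT => //; first exact: measurable_fun_ltr.
have := measurable_level => ml.
by apply: measurable_funD; apply: measurable_funM => //; apply: measurable_funB.
Qed.

Lemma measurable_pareto_density : measurable_fun [set: R] (pareto_density alpha).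
Proof.
have mn : measurable_fun [set: R] (fun x : R => `|x|) by [].
apply: measurable_fun_ifT => //; first exact: measurable_fun_ler.
by apply: measurable_funM => //; exact: (measurableT_comp (measurable_powR _) mn).
Qed.

Section Nonneg.
Variables (cp cm p r : R).
Hypotheses (cp_ge0 : 0 <= cp) (cm_ge0 : 0 <= cm) (p_ge0 : 0 <= p) (r_ge0 : 0 <= r).
Local Notation f := (level_affine cp cm p r).

Lemma level_affine_ge0 x : 0 <= f x.
Proof.
have [ax|xa] := ltP a x; first by rewrite level_affine_gt.
have [xa'|ax] := ltP x (- a); first by rewrite level_affine_lt.
have xa1 : `|x| <= a by rewrite ler_norml ax.
by rewrite level_affine_in// addr_ge0// mulr_ge0 ?level_ge0// subr_ge0 level_le1.
Qed.

Lemma integral_pareto_fold M : 0 <= M ->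
  (\int[leb]_z (f (M * z)%R * pareto_density alpha z)%:E =
   \int[leb]_(z in `[(1:R)%R, +oo[)
     (alpha * z `^ (- (2 * alpha + 1)) * (f (M * z) + f (- (M * z)))%R)%:E)%E.
Proof.
move=> M0; rewrite ge0_integral_fold; last 2 first.
- apply: measurable_funM; last exact: measurable_pareto_density.
  apply: (measurableT_comp (measurable_level_affine _ _ _ _)).
  exact: measurable_funM.
- move=> z; rewrite mulr_ge0 ?level_affine_ge0// /pareto_density.
  by case: ifP => // _; rewrite mulr_ge0 ?powR_ge0// ltW.
rewrite integral_mkcond [RHS]integral_mkcond; apply: eq_integral => z _.
rewrite /patch !mem_setE !in_itv/= !andbT /pareto_density normrN mulrN.
have [z0|z0] := leP 0 z.
  rewrite ger0_norm//; case: ifP => _; last by rewrite !mulr0 addr0.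
  by rewrite -mulrDl mulrC.
by rewrite leNgt (lt_trans z0).
Qed.

(** The symmetric Pareto law scaled by M lives on |z| >= M > a, so it only sees the two outer
    values, each with probability 1/2. *)
Lemma integral_pareto_out M : a < M ->
  (\int[leb]_z (f (M * z)%R * pareto_density alpha z)%:E = ((cp + cm) / 2)%:E)%E.
Proof.
move=> aM; have M0 : 0 < M by exact: lt_trans aM.
rewrite integral_pareto_fold ?ltW//.
transitivity (\int[leb]_(z in `[(1:R)%R, +oo[)
    ((alpha * (cp + cm))%R * z `^ (- (2 * alpha + 1)))%:E)%E.
  apply: eq_integral => z; rewrite inE/= in_itv/= andbT => z1.
  have aMz : a < M * z by rewrite (lt_le_trans aM)// ler_peMr// ltW.
  rewrite level_affine_gt// level_affine_lt ?ltrN2//.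
  by congr EFin; rewrite mulrAC.
have k0 : 0 <= alpha * (cp + cm) by rewrite mulr_ge0 ?addr_ge0 ?(ltW alpha_gt0).
rewrite integral_powR_tail ?mulr_gt0// powR1.
by congr EFin; field; rewrite gt_eqF.
Qed.

(** The folded integral is cut at b = a / M, where M z leaves [-a, a]. Since b^(-alpha) = level M,
    the Pareto mass beyond b is (level M)^2, which explains the coefficient of the outer mean. *)
Lemma integral_pareto_in M : 0 < M -> M <= a ->
  (\int[leb]_z (f (M * z)%R * pareto_density alpha z)%:E =
   ((cp + cm) / 2 * level M ^+ 2 + p * (1 - level M) ^+ 2
    + 2 * r * level M * (1 - level M))%:E)%E.
Proof.
move=> M0 Ma; set w := level M; set b := a / M.
have b1 : 1 <= b by rewrite ler_pdivlMr// mul1r.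
have b0 : 0 < b by exact: lt_le_trans b1.
have wE : b `^ (- alpha) = w.
  by rewrite powRN -powR_inv1 ?powR_ge0// -powRrM mulrC powRrM powR_inv1 ?ltW//
    /w /level (gtr0_norm M0) /b invf_div.
have w2E : b `^ (- (2 * alpha)) = w ^+ 2.
  by rewrite mulrC -mulNr powRrM wE powR_mulrn ?level_ge0.
rewrite integral_pareto_fold ?ltW//.
have mh : measurable_fun [set: R] (fun z : R =>
    alpha * z `^ (- (2 * alpha + 1)) * (f (M * z) + f (- (M * z)))).
  have mf := measurable_level_affine cp cm p r.
  have mM : measurable_fun [set: R] (fun z : R => M * z) by exact: measurable_funM.
  apply: measurable_funM; first exact: measurable_funM.
  apply: measurable_funD; first exact: (measurableT_comp mf).
  by apply: (measurableT_comp mf); exact: measurableT_comp.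
have -> : `[(1:R), +oo[%classic = `[1, b] `|` `]b, +oo[ :> set R.
  by rewrite -itv_bndbnd_setU// bnd_simp.
rewrite ge0_integral_setU//=; last 3 first.
- by apply/measurable_EFinP; exact: measurable_funTS.
- move=> z _; rewrite lee_fin mulr_ge0 ?addr_ge0 ?level_affine_ge0//.
  by rewrite mulr_ge0 ?powR_ge0// ltW.
- apply/disj_setPRL => z/=; rewrite !in_itv/= andbT => bz /andP[_].
  by rewrite leNgt bz.
have zM (z : R) : (M * z <= a) = (z <= b) by rewrite /b ler_pdivlMr// mulrC.
have levelM (z : R) : 0 <= z -> level (M * z) = w * z `^ alpha.
  move=> z0; rewrite /level normrM (ger0_norm z0) mulrAC powRM//.
  by rewrite divr_ge0// ltW.
(* On [1, b] the level of M z is w z^alpha, so the two inner values add up to 2 (p + (r - p) w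
   z^alpha); beyond b they are [cp] and [cm]. *)
transitivity (
  \int[leb]_(z in `[(1:R)%R, b])
     ((2 * alpha * p)%R * z `^ (- (2 * alpha + 1))
      + (2 * alpha * (r - p) * w)%R * z `^ (- (alpha + 1)))%:E
  + \int[leb]_(z in `]b, +oo[)
     ((alpha * (cp + cm))%R * z `^ (- (2 * alpha + 1)))%:E)%E.
  congr (_ + _)%E; apply: eq_integral => z; rewrite inE/= in_itv/= ?andbT.
    move=> /andP[z1 zb]; have z0 : 0 < z by exact: lt_le_trans z1.
    have Mza : `|M * z| <= a by rewrite ger0_norm ?zM// mulr_ge0// ltW.
    rewrite !level_affine_in ?normrN// levelN levelM ?ltW//.
    have -> : z `^ (- (alpha + 1)) = z `^ alpha * z `^ (- (2 * alpha + 1)).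
      rewrite -powRD; last by rewrite (gt_eqF z0) implybT.
      by congr (_ `^ _); ring.
    by congr EFin; ring.
  move=> bz; have aMz : a < M * z by rewrite ltNge zM -ltNge.
  rewrite level_affine_gt// level_affine_lt ?ltrN2//.
  by congr EFin; rewrite mulrAC.
have k0 : 0 <= alpha * (cp + cm) by rewrite mulr_ge0 ?addr_ge0 ?(ltW alpha_gt0).
rewrite integral_itv_obnd_cbnd; last first.
  apply/measurable_EFinP/measurable_funTS; apply: measurable_funM => //.
have s0 : 0 < 2 * alpha by rewrite mulr_gt0.
rewrite integral_powR_tail// integral_powR_segment// wE w2E -EFinD.
by congr EFin; field; rewrite gt_eqF.
Qed.

Local Notation kendall_pair x y :=
  (kendall_pair_int alpha (fun z => (f z)%:E) x y).

Lemma kendall_pair_intC x y : kendall_pair x y = kendall_pair y x.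
Proof. by rewrite /kendall_pair_int maxC minC. Qed.

Lemma kendall_pair_out x y : a < Num.max `|x| `|y| ->
  kendall_pair x y = ((cp + cm) / 2)%:E.
Proof.
rewrite /kendall_pair_int; set M := Num.max _ _ => aM /=.
have M0 : 0 < M by exact: lt_trans aM.
rewrite (integral_pareto_out _ aM) level_affine_gt// level_affine_lt ?ltrN2//.
by rewrite -!EFinM -!EFinD; congr EFin; field.
Qed.

(** If |y| <= |x|, then level y = rho^alpha * level x. Substituting this in the mixture of the
    Pareto part and the atoms at |x| and -|x| removes rho, and the result is symmetric and affine in
    each level separately. *)
Lemma kendall_pair_in x y : `|x| <= a -> `|y| <= a ->
  kendall_pair x y =
  ((cp + cm) / 2 * level x * level y + p * (1 - level x) * (1 - level y)
   + r * (level x * (1 - level y) + (1 - level x) * level y))%:E.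
Proof.
wlog yx : x y / `|y| <= `|x|.
  move=> wlg xa ya; have [/wlg->//|xy] := leP `|y| `|x|.
  by rewrite kendall_pair_intC (wlg _ _ (ltW xy) ya xa); congr EFin; ring.
move=> xa ya; rewrite /kendall_pair_int (max_idPl yx) (min_idPr yx).
(* When M = 0 both points are 0 and the convention rho = 0 leaves only the atom at 0, with value
   [p]; otherwise division by |x| is legitimate. *)
have [x0|x0] := eqVneq `|x| 0.
  have y0 : y = 0.
    by apply: normr0_eq0; apply/eqP; rewrite eq_le normr_ge0 -x0 yx.
  have {}x0 : x = 0 by exact: normr0_eq0.
  rewrite x0 y0 powR0 ?gt_eqF// mul0e add0e normr0 oppr0.
  rewrite !level_affine_in ?normr0 ?ltW// level0 -EFinM /=.
  by congr EFin; field.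
have {}x0 : 0 < `|x| by rewrite lt_neqAle eq_sym x0 normr_ge0.
have levely : level y = (`|y| / `|x|) `^ alpha * level x.
  rewrite /level -powRM ?divr_ge0// ?ltW//.
  by congr (_ `^ _); field; rewrite !gt_eqF.
have levelx : level `|x| = level x by rewrite /level normr_id.
rewrite (integral_pareto_in _ x0 xa) !level_affine_in ?normrN ?normr_id//.
rewrite levelN levelx levely -!EFinM -!EFinD.
by congr EFin; field.
Qed.

End Nonneg.
End KendallStep.

(** * Expressing averages over the step distribution through G and H *)

Section StepDistribution.
Context {R : realType}.
Variables (alpha a : R) (nu : probability R R).
Hypotheses (alpha_gt0 : 0 < alpha) (a_gt0 : 0 < a).
Hypotheses (nu_sym : symmetric_measure nu).
Local Notation G := (funG alpha nu a).
Local Notation H := (funH alpha nu a).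

Definition outside : set R := [set y | a < `|y|].

Definition outside_ind (y : R) : R := \1_outside y.

(** Integrand of the truncated moment a^(-alpha) times the integral of |y|^alpha over [-a, a], the
    second form of H(a). *)
Definition inside_level (y : R) : R := if a < `|y| then 0 else level alpha a y.

Lemma PsiE y : Psi alpha (y / a) = if a < `|y| then 0 else 1 - level alpha a y.
Proof.
rewrite /Psi normrM normfV (gtr0_norm a_gt0) -/(level alpha a y).
case: ltP => [ay|ya]; last by rewrite max_l// subr_ge0 level_le1.
rewrite max_r// subr_le0 /level [leLHS](_ : 1 = 1 `^ alpha); last by rewrite powR1.
rewrite ge0_ler_powR ?nnegrE ?(ltW alpha_gt0) ?divr_ge0 ?(ltW a_gt0)//.
by rewrite ler_pdivlMr// mul1r ltW.
Qed.

Lemma outside_indE y : outside_ind y = if a < `|y| then 1 else 0.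
Proof.
rewrite /outside_ind indicE; case: ifPn => ay; first by rewrite mem_set.
by rewrite memNset// => /=; exact/negP.
Qed.

Lemma outsideE : outside = `]-oo, - a[ `|` `]a, +oo[ :> set R.
Proof.
apply/seteqP; split=> y /=; rewrite /outside/= !in_itv/= andbT ltr_normr ltrNr.
  by move=> /orP[]; [right|left].
by move=> [->|->//]; rewrite orbT.
Qed.

Lemma measurable_outside : measurable outside.
Proof. by rewrite outsideE; exact: measurableU. Qed.

Lemma measurable_outside_ind : measurable_fun [set: R] outside_ind.
Proof. by apply: measurable_indic; exact: measurable_outside. Qed.

Lemma measurable_inside_level : measurable_fun [set: R] inside_level.
Proof.
apply: measurable_fun_ifT => //; first exact: measurable_fun_ltr.
exact: measurable_level.
Qed.

Lemma measurable_Psi : measurable_fun [set: R] (fun y => Psi alpha (y / a)).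
Proof.
rewrite (_ : (fun y => _) =
    fun y : R => if a < `|y| then 0 else 1 - level alpha a y).
  apply: measurable_fun_ifT => //; first exact: measurable_fun_ltr.
  by apply: measurable_funB => //; exact: measurable_level.
by apply/funext => y; rewrite PsiE.
Qed.

Lemma Psi_ge0 y : 0 <= Psi alpha y.
Proof. by rewrite /Psi le_max lexx orbT. Qed.

Lemma inside_level_ge0 y : 0 <= inside_level y.
Proof. by rewrite /inside_level; case: ifP => // _; exact: level_ge0. Qed.

Lemma outside_ind_ge0 y : 0 <= outside_ind y.
Proof. by rewrite outside_indE; case: ifP. Qed.

(** A partition of unity: the masses of the three pieces under [nu] add up to 1, so two of them
    determine the third. *)
Lemma Psi_inside_outside y :
  outside_ind y + inside_level y + Psi alpha (y / a) = 1.
Proof. by rewrite outside_indE /inside_level PsiE; case: ifP => _; ring. Qed.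

Lemma ge0_integral_combination (k1 k2 k3 : R) : 0 <= k1 -> 0 <= k2 -> 0 <= k3 ->
  (\int[nu]_y (k1 * outside_ind y + k2 * inside_level y
              + k3 * Psi alpha (y / a))%:E
   = k1%:E * \int[nu]_y (outside_ind y)%:E
     + k2%:E * \int[nu]_y (inside_level y)%:E
     + k3%:E * \int[nu]_y (Psi alpha (y / a))%:E)%E.
Proof.
move=> k10 k20 k30.
have m1 := measurable_outside_ind; have m2 := measurable_inside_level.
have m3 := measurable_Psi.
have g1 := outside_ind_ge0; have g2 := inside_level_ge0.
have g3 y := Psi_ge0 (y / a).
under eq_integral do rewrite !EFinD !EFinM.
rewrite ge0_integralD//; last 4 first.
- by move=> y _; rewrite -!EFinM -EFinD lee_fin addr_ge0// mulr_ge0.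
- under eq_fun do rewrite -!EFinM -EFinD.
  by apply/measurable_EFinP; apply: measurable_funD; exact: measurable_funM.
- by move=> y _; rewrite -!EFinM lee_fin mulr_ge0.
- under eq_fun do rewrite -!EFinM.
  by apply/measurable_EFinP; exact: measurable_funM.
rewrite ge0_integralD//; last 4 first.
- by move=> y _; rewrite -!EFinM lee_fin mulr_ge0.
- under eq_fun do rewrite -!EFinM.
  by apply/measurable_EFinP; exact: measurable_funM.
- by move=> y _; rewrite -!EFinM lee_fin mulr_ge0.
- under eq_fun do rewrite -!EFinM.
  by apply/measurable_EFinP; exact: measurable_funM.
rewrite !ge0_integralZl_EFin//.
all: try by move=> y _; rewrite lee_fin.
all: exact/measurable_EFinP.
Qed.

Lemma integral_probability_cst (k : R) : (\int[nu]_y k%:E = k%:E)%E.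
Proof.
rewrite integral_cst// [X in (_ * X)%E](_ : _ = 1%E) ?mule1//.
exact: probability_setT.
Qed.

(** By symmetry of [nu], the tail below -a has the same mass as the tail above a. *)
Lemma probability_outside : nu outside = (2 * (1 - cdfF nu a))%:E.
Proof.
have nuE (A : set R) : measurable A -> nu A = (fine (nu A))%:E.
  by move=> mA; rewrite fineK; last exact: fin_num_measure.
have tail : fine (nu `]a, +oo[%classic) = 1 - cdfF nu a.
  by rewrite /cdfF -setCitvl probability_setC// fineB // fin_num_measure.
have opp : nu `]-oo, - a[%classic = nu `]a, +oo[%classic.
  rewrite -nu_sym//; congr (nu _); apply/seteqP.
  by split=> y /=; rewrite !in_itv/= ?andbT ltrN2.
have split_tails : (nu (`]-oo, (- a)%R[%classic `|` `]a, +oo[%classic)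
    = nu `]-oo, (- a)%R[%classic + nu `]a, +oo[%classic)%E.
  rewrite measureU//; apply/seteqP; split=> y //=.
  rewrite !in_itv/= andbT => -[ya ay].
  by move: (lt_trans ay ya); rewrite ltNge ge0_cp// ltW.
by rewrite outsideE split_tails opp nuE// tail -EFinD; congr EFin; ring.
Qed.

(** [funG] is defined through [fine]; the bound of Psi by 1 shows that the integral is finite and
    nothing is lost. *)
Lemma integral_Psi : (\int[nu]_y (Psi alpha (y / a))%:E = G%:E)%E.
Proof.
rewrite /funG fineK// ge0_fin_numE; last first.
  by apply: integral_ge0 => y _; rewrite lee_fin Psi_ge0.
apply: (@le_lt_trans _ _ (\int[nu]_y (1%:E))%E); last first.
  by rewrite integral_probability_cst ltry.
apply: ge0_le_integral => //.
- by move=> y _; rewrite lee_fin Psi_ge0.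
- by apply/measurable_EFinP; exact: measurable_Psi.
- move=> y _; rewrite lee_fin -(Psi_inside_outside y) lerDr.
  by rewrite addr_ge0 ?outside_ind_ge0 ?inside_level_ge0.
Qed.

Lemma integral_outside_ind :
  (\int[nu]_y (outside_ind y)%:E = (1 - G - H)%:E)%E.
Proof.
rewrite integral_indic//; last exact: measurable_outside.
rewrite setIT; transitivity (nu outside) => //.
by rewrite probability_outside /funH; congr EFin; ring.
Qed.

(** Identifies 2F - 1 - G with the truncated moment, by integrating the partition of unity and
    subtracting the two known pieces. *)
Lemma integral_inside_level : (\int[nu]_y (inside_level y)%:E = H%:E)%E.
Proof.
have := ge0_integral_combination 1 1 1 ler01 ler01 ler01.
under eq_integral do rewrite !mul1r Psi_inside_outside.
rewrite integral_probability_cst !mul1e.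
rewrite integral_outside_ind integral_Psi.
(* Infinite values contradict a total equal to 1. *)
case: (\int[nu]_y (inside_level y)%:E)%E => [h||]//.
by rewrite -!EFinD => -[h1]; congr EFin; lra.
Qed.

Lemma funG_ge0 : 0 <= G.
Proof.
by rewrite -lee_fin -integral_Psi integral_ge0// => y _; rewrite lee_fin Psi_ge0.
Qed.

Lemma funH_ge0 : 0 <= H.
Proof.
rewrite -lee_fin -integral_inside_level integral_ge0// => y _.
by rewrite lee_fin inside_level_ge0.
Qed.

Lemma subr_funGH_ge0 : 0 <= 1 - G - H.
Proof.
rewrite -lee_fin -integral_outside_ind integral_ge0// => y _.
by rewrite lee_fin outside_ind_ge0.
Qed.

Lemma funG_le1 : G <= 1.
Proof. by have := subr_funGH_ge0; have := funH_ge0; lra. Qed.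

(** If G = 1, then the outside and inside pieces both have integral 0. Their sum is positive away
    from 0, so [nu] would be concentrated at 0, where it has no mass. *)
Lemma funG_lt1 : nu [set 0] = 0%E -> G < 1.
Proof.
move=> nu0; rewrite lt_neqAle funG_le1 andbT; apply/eqP => GE.
have H0 : H = 0 by have := subr_funGH_ge0; have := funH_ge0; rewrite GE; lra.
(* Weight 0 on Psi keeps exactly the two pieces whose sum is positive off the origin. *)
have := ge0_integral_combination 1 1 0 ler01 ler01 (lexx 0).
rewrite integral_outside_ind integral_inside_level H0 GE.
rewrite integral_Psi mul0e subrr subr0 !mule0 !adde0.
set g := fun y : R => 1 * outside_ind y + 1 * inside_level y + 0 * Psi alpha (y / a).
rewrite -/(\int[nu]_y (g y)%:E)%E => int_g.
have g_gt0 y : y != 0 -> 0 < g y.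
  move=> y0; rewrite /g !mul1r mul0r addr0 outside_indE /inside_level.
  by case: ifP => _; rewrite ?addr0 ?add0r// powR_gt0// divr_gt0// normr_gt0.
have g_ge0 y : 0 <= g y.
  by rewrite !addr_ge0 ?mulr_ge0 ?outside_ind_ge0 ?inside_level_ge0 ?Psi_ge0.
have mg : measurable_fun [set: R] (fun y => (g y)%:E).
  apply/measurable_EFinP; apply: measurable_funD; last first.
    by apply: measurable_funM => //; exact: measurable_Psi.
  apply: measurable_funD; apply: measurable_funM => //.
    exact: measurable_outside_ind.
  exact: measurable_inside_level.
have : ae_eq nu setT (fun y => (g y)%:E) (cst 0%E).
  apply/(ae_eq_integral_abs nu measurableT mg).
  by under eq_integral do rewrite gee0_abs ?lee_fin//.
move=> [N [mN N0 gN]].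
have : (nu (~` [set 0%R]) <= nu N)%E.
  apply: le_measure; rewrite ?inE//; first exact: measurableC.
  move=> y /= /eqP y0; apply: gN => /= /(_ I) gy0.
  by have := g_gt0 y y0; rewrite -lte_fin gy0 ltxx.
by rewrite probability_setC// nu0 sube0 N0 lee_fin ler10.
Qed.


(** * The transition kernel on level-affine functions *)

Section Kernel.
Variables (cp cm p r : R).
Hypotheses (cp_ge0 : 0 <= cp) (cm_ge0 : 0 <= cm) (p_ge0 : 0 <= p) (r_ge0 : 0 <= r).
Local Notation K := (kendall_kernel alpha nu
  (fun z => (level_affine alpha a cp cm p r z)%:E)).

Lemma kendall_kernel_out x : a < `|x| -> K x = ((cp + cm) / 2)%:E.
Proof.
move=> ax; rewrite /kendall_kernel.
under eq_integral.
  move=> y _; rewrite kendall_pair_out//; last by rewrite lt_max ax.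
  over.
by rewrite integral_probability_cst.
Qed.

(** Integrating the bilinear pair value in y replaces the outside, inside and Psi pieces by 1 - G -
    H, H and G. In the coefficient of [level] x the outer mean is collected twice, with weights 1 -
    G - H and H, hence the weight 1 - G. *)
Lemma kendall_kernel_in x : `|x| <= a -> K x =
  (((cp + cm) / 2 * (1 - G - H) + p * G + r * H) * (1 - level alpha a x)
   + ((cp + cm) / 2 * (1 - G) + r * G) * level alpha a x)%:E.
Proof.
move=> xa; rewrite /kendall_kernel; set u := level alpha a x.
have u0 : 0 <= u by exact: level_ge0.
have u1 : 0 <= 1 - u by rewrite subr_ge0 level_le1.
have c0 : 0 <= (cp + cm) / 2 by rewrite divr_ge0 ?addr_ge0.
(* For fixed x the pair value is regrouped according to y: for |y| <= a, [inside_level] y is level y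
   and Psi is 1 - level y. *)
transitivity (\int[nu]_y ((cp + cm) / 2 * outside_ind y
    + ((cp + cm) / 2 * u + r * (1 - u)) * inside_level y
    + (p * (1 - u) + r * u) * Psi alpha (y / a))%:E)%E.
  apply: eq_integral => y _; rewrite outside_indE /inside_level PsiE.
  case: ltP => ya.
    rewrite kendall_pair_out//; last by rewrite lt_max ya orbT.
    by congr EFin; ring.
  by rewrite kendall_pair_in// -/u; congr EFin; ring.
have k2 : 0 <= (cp + cm) / 2 * u + r * (1 - u).
  by apply: addr_ge0; exact: mulr_ge0.
have k3 : 0 <= p * (1 - u) + r * u by apply: addr_ge0; exact: mulr_ge0.
rewrite ge0_integral_combination//.
rewrite integral_outside_ind integral_inside_level integral_Psi.
by rewrite -!EFinM -!EFinD; congr EFin; ring.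
Qed.

End Kernel.

End StepDistribution.

(** * Recursion for the first-passage coefficients and its solution *)

Section FirstPassage.
Context {R : realType}.
Variables (alpha a : R) (nu : probability R R).
Hypotheses (alpha_gt0 : 0 < alpha) (a_gt0 : 0 < a).
Hypotheses (nu_sym : symmetric_measure nu).
Local Notation G := (funG alpha nu a).
Local Notation H := (funH alpha nu a).

(* Coefficients at level 1 ([edge]) and at level 0 ([center]) of the
   first-passage function [first_passage_aux alpha nu a n] on [-a, a]. *)
Fixpoint passage_edge (n : nat) : R :=
  if n is m.+1 then (2^-1) ^+ n * (1 - G) + G * passage_edge m else 0.

Fixpoint passage_center (n : nat) : R :=
  if n is m.+1 then
    (2^-1) ^+ n * (1 - G - H) + G * passage_center m + H * passage_edge m
  else 0.

Lemma passage_edge_ge0 n : 0 <= passage_edge n.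
Proof.
have G1 : 0 <= 1 - G by rewrite subr_ge0 funG_le1.
elim: n => //= n IH; by apply: addr_ge0; apply: mulr_ge0 => //; exact: funG_ge0.
Qed.

Lemma passage_center_ge0 n : 0 <= passage_center n.
Proof.
elim: n => //= n IH; apply: addr_ge0; first (apply: addr_ge0); apply: mulr_ge0 => //.
- exact: subr_funGH_ge0.
- exact: funG_ge0.
- exact: funH_ge0.
- exact: passage_edge_ge0.
Qed.

(* The factor 2^-n: from below [-a] the walk never re-enters [-a, a], and each
   step has a fair sign. *)
Lemma first_passage_affine n :
  first_passage_aux alpha nu a n =
  fun y => (level_affine alpha a (n == 0)%:R ((0 < n)%:R * (2^-1) ^+ n)
              (passage_center n) (passage_edge n) y)%:E.
Proof.
elim: n => [|n IH]; apply/funext => y.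
  rewrite /= mul0r /level_affine mul0r mul0r addr0.
  by case: ifP => // _; case: ifP.
rewrite /= IH; case: leP => [ya|ay]; last by rewrite level_affine_gt.
(* The outer values are (1, 0) for n = 0 and (0, 2^-n) afterwards; their sum is 2^-n in both cases,
   so the outer mean is 2^-(n+1). *)
have cE : (n == 0)%:R + (0 < n)%:R * (2^-1) ^+ n = (2^-1) ^+ n :> R.
  by case: n {IH} => [|n]; rewrite /= ?mul0r ?addr0 ?add0r ?mul1r ?expr0.
have cp0 : 0 <= (n == 0)%:R :> R by exact: ler0n.
have cm0 : 0 <= (0 < n)%:R * (2^-1) ^+ n :> R by rewrite mulr_ge0 ?ler0n ?exprn_ge0.
have p0 := passage_center_ge0 n; have r0 := passage_edge_ge0 n.
have [ya'|ay] := ltP y (- a).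
  rewrite kendall_kernel_out//; last by rewrite ltr_normr ltrNr ya' orbT.
  by rewrite level_affine_lt// cE mul1r exprSr.
have yin : `|y| <= a by rewrite ler_norml ay.
rewrite kendall_kernel_in// level_affine_in// cE exprSr.
by congr EFin; ring.
Qed.

(** The walk starts at 0, which has level 0, so only the centre coefficient survives. As 0 <= a, the
    killing at the starting point has no effect, which accounts for the index shift. *)
Lemma prob_tau_center n : prob_tau alpha nu a n.+1 = (passage_center n.+1)%:E.
Proof.
transitivity (first_passage_aux alpha nu a n.+1 0); first by rewrite /= ltW.
rewrite first_passage_affine level_affine_in ?normr0 ?ltW// level0//.
by rewrite subr0 mulr1 mulr0 addr0.
Qed.

(** A scalar linear recursion with eigenvalue G driven by 2^-n; G different from 1/2 rules out
    resonance between the two. *)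
Lemma passage_edge_closed n : G != 2^-1 ->
  passage_edge n = (1 - G) / (1 - 2 * G) * ((2^-1) ^+ n - G ^+ n).
Proof.
move=> G2; have D0 : 1 - 2 * G != 0.
  by apply: contra G2 => /eqP D; apply/eqP; lra.
elim: n => [|n IH]; first by rewrite !expr0 subrr mulr0.
by rewrite /= IH !exprS; field.
Qed.

(** The edge sequence drives the centre recursion and its G^n part has the centre's own eigenvalue,
    whence the term in [n.+1%:R]. The induction starts from the value (1 - G - H) / 2 at index 1. *)
Lemma passage_center_closed n : G != 2^-1 -> G != 1 ->
  passage_center n.+1 =
  (1 + H / (2 * G - 1) ^+ 2 - G / (2 * G - 1)) * (2^-1) ^+ n.+1
  + H / ((2 * G - 1) * (1 - G)) * n.+1%:R * (1 - G) ^+ 2 * G ^+ n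
  + (G / (2 * G - 1) - H / (2 * G - 1) ^+ 2 * (G / (1 - G))) * G ^+ n * (1 - G).
Proof.
move=> G2 G1; have D0 : 1 - 2 * G != 0.
  by apply: contra G2 => /eqP D; apply/eqP; lra.
have D1 : 2 * G - 1 != 0 by rewrite -opprB oppr_eq0.
have D2 : 1 - G != 0 by rewrite subr_eq0 eq_sym.
elim: n => [|n IH].
  by rewrite /= !mulr0 !addr0 !expr0 expr1; field; rewrite D1 D2.
rewrite [LHS]/= -/(passage_center n.+1) -/(passage_edge n.+1) IH.
rewrite passage_edge_closed// -[n.+2]addn1 natrD addn1 !exprS.
by field; rewrite D0 D1 D2.
Qed.

End FirstPassage.

Theorem mainTheorem12 (R : realType) (alpha : R) (nu : probability R R) (a : R) :
  0 < alpha ->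
  symmetric_measure nu ->
  nu [set 0] = 0%E ->
  0 < a ->
  nu [set a] = 0%E ->
  funG alpha nu a != 2^-1 ->
  let G := funG alpha nu a in
  let H := funH alpha nu a in
  let A := 1 + H / (2 * G - 1) ^+ 2 - G / (2 * G - 1) in
  let B := H / ((2 * G - 1) * (1 - G)) in
  let C := G / (2 * G - 1) - H / (2 * G - 1) ^+ 2 * (G / (1 - G)) in
  (forall n : nat, (1 <= n)%N ->
     prob_tau alpha nu a n =
     (A * (2^-1) ^+ n + B * n%:R * (1 - G) ^+ 2 * G ^+ n.-1
      + C * G ^+ n.-1 * (1 - G))%:E)
  /\ A + B + C = 1.
Proof.
move=> alpha_gt0 nu_sym nu0 a_gt0 _ G2 G H A B C.
(* The absence of an atom at 0 makes the denominators 1 - G in B and C nonzero. *)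
have G1 : G != 1 by rewrite lt_eqF// funG_lt1.
split=> [[//|n] _|].
  by rewrite prob_tau_center// passage_center_closed.
have D1 : 2 * G - 1 != 0.
  by apply: contra G2 => /eqP D; apply/eqP; rewrite -/G; lra.
have D2 : 1 - G != 0 by rewrite subr_eq0 eq_sym.
by rewrite /A /B /C; field; rewrite D1 D2.
Qed.
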